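(* Let $d \ge 1$ and let $(x_n)_{n \in \mathbb{N}}$ be a low-discrepancy sequence in $[0,1)^d$, regarded as the $d$-dimensional torus equipped with $\|\cdot\|_\infty$. Then $(x_n)_{n\in\mathbb{N}}$ has $\alpha$-pair correlations (with respect to $\|\cdot\|_\infty$) for all $0 < \alpha < \tfrac{1}{d}$.
   Context: For $x \in \mathbb{R}$ let $\|x\|$ denote the distance of $x$ to the nearest integer, and for $x=(x_1,\ldots,x_d) \in \mathbb{R}^d$ put $\|x\|_\infty := \max(\|x_1\|,\ldots,\|x_d\|)$. Let $B(0,r)$ be the ball of radius $r$ around $0$ in the torus $[0,1)^d$ with respect to $\|\cdot\|_\infty$, and $\mathrm{vol}$ the Lebesgue volume. For $0<\alpha<\tfrac1d$ a sequence $(x_n)_{n\in\mathbb{N}}$ in $[0,1)^d$ has $\alpha$-pair correlations if for all $s>0$ $$\lim_{N\to\infty} \frac{1}{N^2}\, \frac{\#\{1 \le l \ne m \le N : \|x_l-x_m\|_\infty \le s N^{-\alpha}\}}{\mathrm{vol}(B(0,sN^{-\alpha}))} = 1,$$ where the pairs $(l,m)$ are ordered. The star-discrepancy of the first $N$ terms is $$D_N^*(x_n) := \sup_{B^*=[0,b) \subset [0,1)^d} \left| \tfrac{1}{N}\#\{1\le i\le N : x_i \in B^*\} - \lambda_d(B^* )\right|,$$ the supremum being over all boxes $[0,b)=\prod_{i=1}^d [0,b_i)$ contained in $[0,1)^d$, and $\lambda_d$ denoting Lebesgue measure. A sequence in $[0,1)^d$ is a low-discrepancy sequence if $D_N^*(x_n)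 = O(N^{-1}(\log N)^d)$ as $N \to \infty$. *)

(* Defs.v *)
From HB Require Import structures.
From mathcomp Require Import all_boot all_order all_algebra.
From mathcomp Require Import all_classical all_reals all_analysis measurable_realfun.
Import Order.TTheory GRing.Theory Num.Theory.
Import numFieldNormedType.Exports.

Set Implicit Arguments.
Unset Strict Implicit.
Unset Printing Implicit Defensive.

Local Open Scope classical_set_scope.
Local Open Scope ring_scope.

(* Iterated integration of one-dimensional Lebesgue measure, one coordinate at
   a time; [lebesgue_tuple_box] gives its value on products of sets. *)
Fixpoint lebesgue_tuple (R : realType) (n : nat) :
    set (n.-tuple R) -> \bar R :=
  match n with
  | 0 => fun A => \d_([tuple] : 0.-tuple R) A
  | m.+1 => fun A => (\int[@lebesgue_measure R]_x
               lebesgue_tuple [set t : m.-tuple R | A [tuple of x :: t]])%E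
  end.

Lemma lebesgue_tuple0 (R : realType) (n : nat) :
  lebesgue_tuple (set0 : set (n.-tuple R)) = 0%E.
Proof.
case: n => [|n] /=; first by rewrite dirac0.
elim: n => [|n IH] /=; apply: integral0_eq => x _; first by rewrite dirac0.
exact: IH.
Qed.

Lemma lebesgue_tuple_box (R : realType) (n : nat)
    (A : 'I_n -> set (measurableTypeR R)) (hA : forall i, measurable (A i)) :
  lebesgue_tuple [set t : n.-tuple R | forall i, A i (tnth t i)] =
  (\prod_(i < n) lebesgue_measure (A i))%E.
Proof.
elim: n A hA => [|n IH] A hA /=.
  rewrite big_ord0 diracE mem_set //=.
  by case.
rewrite big_ord_recl /=.
set B := [set t : n.-tuple R | forall i, A (lift ord0 i) (tnth t i)].
have IHB := IH (fun i => A (lift ord0 i)) (fun i => hA _).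
rewrite -/B in IHB.
transitivity (\int[@lebesgue_measure R]_x
    ((lebesgue_tuple B) * (\1_(A ord0) x)%:E))%E.
  apply: eq_integral => x _; rewrite indicE.
  case: (boolP (x \in A ord0)) => [/set_mem xA|/negP xA]; last first.
    rewrite mule0 -[RHS](lebesgue_tuple0 R n); congr lebesgue_tuple.
    apply/seteqP; split => t //= /(_ ord0); rewrite tnth0 => h.
    by apply: xA; apply/mem_set.
  rewrite mule1; congr lebesgue_tuple.
  apply/seteqP; split => t /= h i; first by have := h (lift ord0 i); rewrite tnthS.
  by case: (unliftP ord0 i) => [j|] ->; rewrite ?tnth0 ?tnthS.
have B0 : (0 <= lebesgue_tuple B)%E.
  rewrite IHB; elim/big_ind : _ => // x y; exact: mule_ge0.
rewrite ge0_integralZl //.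
- by rewrite integral_indic // setIT IHB muleC.
- by apply/measurable_EFinP; exact: measurable_indic.
Qed.

Definition nearest_int_dist (R : realType) (x : R) : R :=
  inf [set `|x - k%:~R| | k in [set: int]].

Definition torus_norm (R : realType) (d : nat) (x : d.-tuple R) : R :=
  \big[Num.max/0]_(i < d) nearest_int_dist (tnth x i).

Definition tuple_sub (R : realType) (d : nat) (x y : d.-tuple R) : d.-tuple R :=
  [tuple tnth x i - tnth y i | i < d].

Definition unit_cube (R : realType) (d : nat) : set (d.-tuple R) :=
  [set x | forall i, 0 <= tnth x i < 1].
Arguments unit_cube {R} d.

Definition torus_ball0 (R : realType) (d : nat) (r : R) : set (d.-tuple R) :=
  [set x | unit_cube d x /\ torus_norm x <= r].
Arguments torus_ball0 {R} d r.

Definition volume (R : realType) (d : nat) (A : set (d.-tuple R)) : R :=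
  fine (lebesgue_tuple A).

(* Sequences are indexed from 0: the first N terms are x 0, ..., x N.-1. *)

Definition close_pairs (R : realType) (d : nat) (x : nat -> d.-tuple R)
    (N : nat) (r : R) : nat :=
  #|[pred p : 'I_N * 'I_N |
      (p.1 != p.2) && (torus_norm (tuple_sub (x p.1) (x p.2)) <= r)]|.

Definition pair_correlations (R : realType) (d : nat) (alpha : R)
    (x : nat -> d.-tuple R) : Prop :=
  forall s : R, 0 < s ->
    (fun N : nat => let r := s * N%:R `^ (- alpha) in
       (N%:R ^+ 2)^-1 *
       ((close_pairs x N r)%:R / volume (torus_ball0 d r)))
      @ \oo --> (1 : R).

Definition anchored_box (R : realType) (d : nat) (b : d.-tuple R) :
    set (d.-tuple R) :=
  [set x | forall i, 0 <= tnth x i < tnth b i].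

Definition star_discrepancy (R : realType) (d : nat) (x : nat -> d.-tuple R)
    (N : nat) : R :=
  sup [set `| #|[pred i : 'I_N | x i \in anchored_box b]|%:R / N%:R
              - volume (anchored_box b) |
      | b in [set b : d.-tuple R | anchored_box b `<=` unit_cube d]].

Definition low_discrepancy (R : realType) (d : nat) (x : nat -> d.-tuple R) :
    Prop :=
  (forall n, unit_cube d (x n)) /\
  star_discrepancy x =O_\oo (fun N : nat => N%:R^-1 * ln (N%:R : R) ^+ d).

(* Main.v *)
Require Import Defs.
From HB Require Import structures.
From mathcomp Require Import all_boot all_order all_algebra.
From mathcomp Require Import all_classical all_reals all_analysis.
From mathcomp Require Import ring lra.
Import Order.TTheory GRing.Theory Num.Theory.
Import numFieldNormedType.Exports.
Local Open Scope classical_set_scope.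
Local Open Scope ring_scope.

Set Implicit Arguments.
Unset Strict Implicit.
Unset Printing Implicit Defensive.

(** Fix [N] and a small radius [r = s N^-alpha].  Grouping the close pairs by
    their first entry [x l], one has to count the points [x m] in the torus
    ball of radius [r] around [x l].  That ball is a product of arcs, and each
    arc, cut open at [0], is a signed combination of six intervals [[0, b)];
    multiplying out, the ball is a signed combination of [6 ^ d] anchored
    boxes.  The star-discrepancy [D] therefore controls the count uniformly in
    the centre: it is [N ((2r)^d + O(D))] ([torus_ball_deviation]).

    Summing over [l] and removing the [N] diagonal pairs, the number of close
    pairs divided by [N^2] is [(2r)^d + O(D + 1/N)] ([close_pairs_deviation]).
    As soon as [2r < 1] the ball has volume [(2r)^d] ([volume_torus_ball0]), so
    the pair correlation ratio differs from [1] by [O((D + 1/N) / r^d)].  For a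
    low-discrepancy sequence this is
    [O(N^-1 (ln N)^d N^(alpha d)) = O(N^-b (ln N)^d)] with
    [b = 1 - alpha d > 0], which tends to [0] ([lnX_powR_cvg0]). *)

(** * Arcs of the circle as signed sums of anchored intervals *)

Definition clip01 (R : realType) (t : R) : R := Num.max 0 (Num.min 1 t).

Lemma clip01_itv (R : realType) (t : R) : 0 <= clip01 t <= 1.
Proof. by rewrite /clip01 !maxEle !minEle; repeat case: ifP; lra. Qed.

Lemma lt_clip01 (R : realType) (y t : R) : 0 <= y < 1 -> (y < clip01 t) = (y < t).
Proof.
move=> hy; rewrite /clip01 !maxEle !minEle; apply/idP/idP; repeat case: ifP; lra.
Qed.

(** The arc from [u] to [v] lifts to the line as the union of the intervals
    [[u + k, v + k)], of which only [k = -1, 0, 1] can meet [[0, 1)] when the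
    endpoints are in [[-1, 2]].  In [k : bool * 'I_3] the second component
    selects the translate (shifted by one to be a natural number) and the first
    one the upper or the lower endpoint.  Clipping makes each endpoint the
    corner of an anchored interval inside [[0, 1)]. *)
Definition arc_endpoint (R : realType) (u v : R) (k : bool * 'I_3) : R :=
  clip01 ((if k.1 then v else u) + (k.2%:R - 1)).

Definition arc_sign (R : realType) (k : bool * 'I_3) : R := if k.1 then 1 else -1.

Definition arc_indicator (R : realType) (u v y : R) : R :=
  \sum_k arc_sign R k * (y < arc_endpoint u v k)%R%:R.

Lemma sum_sheets (R : realType) (F : bool * 'I_3 -> R) :
  \sum_k F k = \sum_(j < 3) (F (true, j) + F (false, j)).
Proof.
rewrite big_split /= -(big_bool _ (fun e => \sum_(j < 3) F (e, j))).
by rewrite pair_bigA; apply: eq_bigr => -[].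
Qed.

(** The clipped translates of [t] always add up to [t + 1], so the signed
    lengths of the anchored intervals add up to the length of the arc. *)
Lemma sum_arc_endpoint (R : realType) (u v : R) :
  -1 <= u <= 2 -> -1 <= v <= 2 ->
  \sum_k arc_sign R k * arc_endpoint u v k = v - u.
Proof.
move=> hu hv; rewrite sum_sheets !big_ord_recl big_ord0 /arc_sign /arc_endpoint /=.
have clip_sum (t : R) : -1 <= t <= 2 ->
    clip01 (t + (0 - 1)) + clip01 (t + (1 - 1)) + clip01 (t + (2 - 1)) = t + 1.
  by move=> ht; rewrite /clip01 !maxEle !minEle; repeat case: ifP; lra.
have := clip_sum _ hu; have := clip_sum _ hv; rewrite /bump /= !addn0.
lra.
Qed.

(** For an arc of length at most [1] the three translates are disjoint: the
    signed sum then really is an indicator function. *)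
Lemma arc_indicatorE (R : realType) (u v y : R) :
  u <= v <= u + 1 -> 0 <= y < 1 ->
  arc_indicator u v y =
  [|| u - 1 <= y < v - 1, u <= y < v | u + 1 <= y < v + 1]%R%:R.
Proof.
move=> huv hy; rewrite /arc_indicator sum_sheets !big_ord_recl big_ord0.
rewrite /arc_sign /arc_endpoint /= !lt_clip01 // /bump /= !addn0.
rewrite !subrr !addr0 (_ : v + (0 - 1) = v - 1); last by ring.
rewrite (_ : u + (0 - 1) = u - 1); last by ring.
rewrite (_ : u + (2 - 1) = u + 1); last by ring.
rewrite (_ : v + (2 - 1) = v + 1); last by ring.
case: (ltP y (v - 1)) => ?; case: (ltP y v) => ?; case: (ltP y (v + 1)) => ?;
case: (ltP y (u - 1)) => ?; case: (ltP y u) => ?; case: (ltP y (u + 1)) => ? /=;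
rewrite ?mulr1n ?mulr0n; lra.
Qed.

(** For [z] in [(-1, 1)] the nearest integer is [-1], [0] or [1]; the infimum
    over all integers becomes a finite disjunction. *)
Lemma nearest_int_dist_le (R : realType) (z r : R) : -1 < z < 1 -> 
  (nearest_int_dist z <= r) = [|| `|z| <= r, `|z - 1| <= r | `|z + 1| <= r].
Proof.
move=> hz; rewrite /nearest_int_dist.
set E := (X in inf X).
have hlb : has_lbound E by exists 0 => _ [k _ <-]; exact: normr_ge0.
have attained (k : int) : inf E <= `|z - k%:~R| by apply: ge_inf => //; exists k.
apply/idP/idP.
  apply: contraTT; rewrite !negb_or -!ltNge => /and3P[h0 h1 h2].
  (* Integers beyond 1 or below -1 are further from z than 1 or -1 are. *)
  have: Num.min `|z| (Num.min `|z - 1| `|z + 1|) <= inf E.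
    apply: lb_le_inf; first by exists `|z - 0%:~R|, 0.
    move=> _ [k _ <-]; rewrite !ge_min.
    case: (ltrgt0P k) => hk.
    + have : 1 <= k%:~R :> R by rewrite (ler_int R 1 k).
      move=> hk'; apply/orP; right; apply/orP; left.
      by rewrite !ler0_norm; lra.
    + have : k%:~R <= -1 :> R by rewrite (ler_int R k (-1)) -ltzD1 addNr.
      move=> hk'; apply/orP; right; apply/orP; right.
      by rewrite !ger0_norm; lra.
    + by rewrite hk subr0 lexx.
  apply: lt_le_trans; rewrite !lt_min; exact/and3P.
case/or3P; apply: le_trans.
- by have := attained 0; rewrite subr0.
- exact: (attained 1).
- by have := attained (-1); rewrite mulrNz opprK.
Qed.

(** Balls are closed whereas anchored boxes are half-open.  The closed arc
    around [c] contains the half-open one with the same endpoints and is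
    contained in any half-open one that extends further by some [e > 0]. *)
Lemma arc_indicator_le_dist (R : realType) (c y r : R) :
  0 <= c < 1 -> 0 <= y < 1 -> 0 <= r <= 1 / 2 ->
  arc_indicator (c - r) (c + r) y <= (nearest_int_dist (c - y) <= r)%R%:R.
Proof.
move=> hc hy hr; rewrite arc_indicatorE ?nearest_int_dist_le; try lra.
rewrite ler_nat !ler_norml; case/orP: (orbN [|| c - r - 1 <= y < c + r - 1,
  c - r <= y < c + r | c - r + 1 <= y < c + r + 1]); last by move/negbTE->.
move=> h; rewrite h; suff -> : [|| - r <= c - y <= r, - r <= c - y - 1 <= r
  | - r <= c - y + 1 <= r] by [].
lra.
Qed.

Lemma dist_le_arc_indicator (R : realType) (c y r e : R) :
  0 <= c < 1 -> 0 <= y < 1 -> 0 <= r -> 0 < e -> r + r + e <= 1 ->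
  (nearest_int_dist (c - y) <= r)%R%:R <= arc_indicator (c - r) (c + r + e) y.
Proof.
move=> hc hy hr he hre; rewrite arc_indicatorE ?nearest_int_dist_le; try lra.
rewrite ler_nat !ler_norml; case/orP: (orbN [|| - r <= c - y <= r, - r <= c - y - 1 <= r
  | - r <= c - y + 1 <= r]); last by move/negbTE->.
move=> h; rewrite h; suff -> : [|| c - r - 1 <= y < c + r + e - 1,
  c - r <= y < c + r + e | c - r + 1 <= y < c + r + e + 1] by [].
lra.
Qed.

(** * Deviation of signed combinations of anchored boxes *)

Lemma volume_anchored_box (R : realType) (d : nat) (b : d.-tuple R) :
  (forall i, 0 <= tnth b i) ->
  volume (anchored_box b) = \prod_(i < d) tnth b i.
Proof.
move=> hb; rewrite /volume.
rewrite (_ : anchored_box b =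
  [set t | forall i, (`[0, tnth b i[ : set R)%classic (tnth t i)]%classic); last first.
  by apply/seteqP; split => t /= h i; have := h i; rewrite in_itv.
rewrite (lebesgue_tuple_box (A := fun i => `[0, tnth b i[%classic)) //.
rewrite -[RHS]/(fine (\prod_(i < d) tnth b i)%:E) -prodEFin.
congr fine; apply: eq_bigr => i _.
rewrite lebesgue_measure_itv /= lte_fin oppr0 adde0.
by case: ltP => // hi; congr EFin; apply/eqP; rewrite eq_le hi hb.
Qed.

Lemma anchored_box0 (R : realType) (d : nat) (b : d.-tuple R) (i : 'I_d) :
  tnth b i <= 0 -> anchored_box b = set0.
Proof.
move=> bi; apply/seteqP; split => // t /(_ i) /=; lra.
Qed.

(** If some [b_i] exceeded [1] while the box is nonempty, it would contain a point
    with [i]-th coordinate [1], outside the half-open cube. *)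
Lemma anchored_box_le1 (R : realType) (d : nat) (b : d.-tuple R) :
  (forall i, 0 < tnth b i) -> (anchored_box b `<=` unit_cube d)%classic ->
  forall i, tnth b i <= 1.
Proof.
move=> hb sub i; rewrite leNgt; apply/negP => bi.
have /sub/(_ i) : anchored_box b [tuple if j == i then 1 else tnth b j / 2 | j < d].
  move=> j; rewrite tnth_mktuple; case: eqP => [->|_]; first by rewrite bi ler01.
  have := hb j; lra.
by rewrite tnth_mktuple eqxx ltxx andbF.
Qed.

(** Without this bound the supremum defining the star-discrepancy would carry a
    default value and dominate nothing. *)
Lemma has_ubound_discrepancy (R : realType) (d : nat) (x : nat -> d.-tuple R) (N : nat) :
  has_ubound [set `| #|[pred i : 'I_N | x i \in anchored_box b]|%:R / N%:R
                     - volume (anchored_box b) |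
      | b in [set b : d.-tuple R | (anchored_box b `<=` unit_cube d)%classic]]%classic.
Proof.
exists (1 + 1) => _ [b /= sub <-].
apply: le_trans (ler_normB _ _) _; apply: lerD.
  case: (posnP N) => [->|N0]; first by rewrite invr0 mulr0 normr0 ler01.
  rewrite ger0_norm ?divr_ge0 // ler_pdivrMr ?ltr0n // mul1r ler_nat.
  by rewrite -[leqRHS]card_ord max_card.
case: (boolP [forall i, 0 < tnth b i]) => [/forallP hb|].
  have b1 := anchored_box_le1 hb sub.
  rewrite volume_anchored_box; last by move=> i; exact: ltW.
  rewrite ger0_norm; last by apply: prodr_ge0 => i _; exact: ltW.
  by apply: prodr_ile1 => i _; rewrite b1 ltW.
rewrite negb_forall => /existsP[i]; rewrite -leNgt => /anchored_box0 ->.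
by rewrite /volume lebesgue_tuple0 normr0 ler01.
Qed.

Lemma prodr_nat_bool (R : realType) (I : finType) (P : pred I) :
  \prod_i (P i)%:R = [forall i, P i]%:R :> R.
Proof.
case: (boolP [forall i, P i]) => [/forallP h|].
  by rewrite big1 // => i _; rewrite h.
rewrite negb_forall => /existsP[i /negbTE hi].
by rewrite (bigD1 i) //= hi mul0r.
Qed.

Lemma sum_nat_bool_card (R : realType) (I : finType) (P : pred I) :
  \sum_i (P i)%:R = #|P|%:R :> R.
Proof. by rewrite -natr_sum -sum1_card [in RHS]big_mkcond. Qed.

Lemma anchored_box_deviation (R : realType) (d : nat) (x : nat -> d.-tuple R)
    (N : nat) (b : d.-tuple R) :
  (forall n, unit_cube d (x n)) -> (forall i, 0 <= tnth b i <= 1) ->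
  `| (\sum_(m < N) \prod_(i < d) (tnth (x m) i < tnth b i)%R%:R) / N%:R
     - \prod_(i < d) tnth b i | <= star_discrepancy x N.
Proof.
move=> hx hb; rewrite -volume_anchored_box; last by move=> i; case/andP: (hb i).
have -> : \sum_(m < N) \prod_(i < d) (tnth (x m) i < tnth b i)%R%:R
    = #|[pred i : 'I_N | x i \in anchored_box b]|%:R :> R.
  rewrite -sum_nat_bool_card; apply: eq_bigr => m _.
  rewrite prodr_nat_bool /=; congr (nat_of_bool _)%:R.
  apply/forallP/idP => [h|/set_mem h i]; last by case/andP: (h i).
  by apply/mem_set => i; rewrite h andbT; case/andP: (hx m i).
apply: ub_le_sup; first exact: has_ubound_discrepancy.
by exists b => //= t ht i; have := ht i; have := hb i; lra.
Qed.

(** Expanding a product of sums over [K] gives one anchored box for each function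
    from the [d] coordinates to [K], each contributing at most one
    star-discrepancy. *)
Lemma signed_box_deviation (R : realType) (d : nat) (K : finType)
    (x : nat -> d.-tuple R) (N : nat) (e b : 'I_d -> K -> R) :
  (forall n, unit_cube d (x n)) ->
  (forall i k, `|e i k| <= 1) -> (forall i k, 0 <= b i k <= 1) ->
  `| (\sum_(m < N) \prod_(i < d) \sum_k e i k * (tnth (x m) i < b i k)%R%:R) / N%:R
     - \prod_(i < d) \sum_k e i k * b i k |
  <= (#|K| ^ d)%:R * star_discrepancy x N.
Proof.
move=> hx he hb.
under eq_bigr => m _ do rewrite bigA_distr_bigA /=.
rewrite exchange_big /= bigA_distr_bigA /= mulr_suml -sumrB.
apply: le_trans (ler_norm_sum _ _ _) _.
have -> : (#|K| ^ d)%:R * star_discrepancy x N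
    = \sum_(f : {ffun 'I_d -> K}) star_discrepancy x N.
  by rewrite sumr_const card_ffun card_ord mulr_natl.
apply: ler_sum => f _.
under eq_bigr => m _ do rewrite big_split /=.
rewrite -mulr_sumr big_split /= -mulrA -mulrBr normrM.
rewrite -[leRHS]mul1r; apply: ler_pM => //.
  by rewrite normr_prod prodr_ile1 // => i _; rewrite normr_ge0 he.
pose t := [tuple b i (f i) | i < d].
have tE i : tnth t i = b i (f i) by rewrite tnth_mktuple.
have := @anchored_box_deviation R d x N t hx.
under [\sum_(m < N) _]eq_bigr => m _ do under eq_bigr => i _ do rewrite tE.
under [X in _ - X]eq_bigr => i _ do rewrite tE.
by apply => i; rewrite tE.
Qed.

(** The factor [6] counts the anchored intervals that make up one arc. *)
Lemma torus_box_deviation (R : realType) (d : nat) (x : nat -> d.-tuple R)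
    (N : nat) (u v : 'I_d -> R) :
  (forall n, unit_cube d (x n)) ->
  (forall i, -1 <= u i <= 2) -> (forall i, -1 <= v i <= 2) ->
  `| (\sum_(m < N) \prod_(i < d) arc_indicator (u i) (v i) (tnth (x m) i)) / N%:R
     - \prod_(i < d) (v i - u i) |
  <= (6 ^ d)%:R * star_discrepancy x N.
Proof.
move=> hx hu hv.
under [X in _ - X]eq_bigr => i _ do rewrite -sum_arc_endpoint //.
have -> : 6%N = #|{: bool * 'I_3}| by rewrite card_prod card_bool card_ord.
apply: signed_box_deviation => // i k; last exact: clip01_itv.
by rewrite /arc_sign; case: ifP; rewrite ?normrN normr1.
Qed.

(** * Torus balls and close pairs *)

Lemma torus_norm_le (R : realType) (d : nat) (z : d.-tuple R) (r : R) : 0 <= r ->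
  (torus_norm z <= r) = [forall i, nearest_int_dist (tnth z i) <= r].
Proof.
move=> r0; apply/idP/forallP => [h i|h].
  by apply: le_trans h; exact: le_bigmax_cond.
by apply: bigmax_le => // i _; exact: h.
Qed.

Lemma close_indicatorE (R : realType) (d : nat) (c y : d.-tuple R) (r : R) :
  0 <= r -> (torus_norm (tuple_sub c y) <= r)%R%:R
  = \prod_(i < d) (nearest_int_dist (tnth c i - tnth y i) <= r)%R%:R :> R.
Proof.
move=> r0; rewrite torus_norm_le // -prodr_nat_bool.
by apply: eq_bigr => i _; rewrite tnth_mktuple.
Qed.

Lemma arc_indicator_ge0 (R : realType) (u v y : R) :
  u <= v <= u + 1 -> 0 <= y < 1 -> 0 <= arc_indicator u v y.
Proof. by move=> huv hy; rewrite arc_indicatorE. Qed.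

(** The count in the closed ball is squeezed between the counts in two products
    of half-open arcs.  The upper product has sides [2r + e]; as the bound holds
    for all small [e > 0] and the count does not depend on [e], letting [e] tend
    to [0] loses nothing. *)
Lemma torus_ball_deviation (R : realType) (d : nat) (x : nat -> d.-tuple R)
    (N : nat) (c : d.-tuple R) (r : R) :
  (forall n, unit_cube d (x n)) -> unit_cube d c -> 0 < r -> r + r < 1 ->
  `| (\sum_(m < N) (torus_norm (tuple_sub c (x m)) <= r)%R%:R) / N%:R
     - (r + r) ^+ d | <= (6 ^ d)%:R * star_discrepancy x N.
Proof.
move=> hx hc r0 r1; set D := (_ * star_discrepancy x N).
have box e : 0 <= e -> e <= 1 - (r + r) ->
    `| (\sum_(m < N) \prod_(i < d)
          arc_indicator (tnth c i - r) (tnth c i + r + e) (tnth (x m) i)) / N%:R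
       - (r + r + e) ^+ d | <= D.
  move=> e0 e1; have := @torus_box_deviation R d x N
    (fun i => tnth c i - r) (fun i => tnth c i + r + e) hx.
  have -> : \prod_(i < d) (tnth c i + r + e - (tnth c i - r)) = (r + r + e) ^+ d.
    rewrite -[in RHS](card_ord d) -prodr_const; apply: eq_bigr => i _; ring.
  by apply => i; have := hc i; lra.
rewrite ler_norml; apply/andP; split.
  have := box 0 (lexx _); rewrite ler_norml => /(_ _)/andP[|low _]; first lra.
  apply: le_trans low _; rewrite addr0 lerD2r ler_wpM2r ?invr_ge0 //.
  apply: ler_sum => m _; rewrite close_indicatorE; last exact: ltW.
  apply: ler_prod => i _; have := hc i; have := hx m i => xm ci.
  rewrite addr0 arc_indicator_ge0; try lra.
  apply: arc_indicator_le_dist; lra.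
rewrite lerBlDr addrC.
set S := (X in X <= _).
have up e : 0 < e -> e <= 1 - (r + r) -> S <= (r + r + e) ^+ d + D.
  move=> e0 e1; have := box e (ltW e0) e1; rewrite ler_norml => /andP[_].
  rewrite lerBlDr addrC; apply: le_trans.
  rewrite ler_wpM2r ?invr_ge0 //; apply: ler_sum => m _.
  rewrite close_indicatorE; last exact: ltW.
   apply: ler_prod => i _.
  have := hc i; have := hx m i => xm ci.
  by rewrite ler0n dist_le_arc_indicator; lra.
apply: (@cvgr_to_ge R (at_right 0) _ R (fun e => (r + r + e) ^+ d + D)).
  apply: cvgD; last exact: cvg_cst.
  apply: (cvg_comp (fun e => r + r + e) (fun y => y ^+ d));
    last exact: exprn_continuous.
  have : r + r + e @[e --> (0 : R)^'+] --> r + r + 0.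
    by apply: cvgD; [exact: cvg_cst | exact: cvg_at_right_filter].
  by rewrite addr0.
near=> e; apply: up; first by near: e; exact: nbhs_right_gt.
by near: e; apply: nbhs_right_le; lra.
Unshelve. all: by end_near. Qed.

Lemma torus_norm_tuple_subxx (R : realType) (d : nat) (c : d.-tuple R) (r : R) :
  0 <= r -> torus_norm (tuple_sub c c) <= r.
Proof.
move=> r0; rewrite torus_norm_le //; apply/forallP => i.
rewrite tnth_mktuple subrr nearest_int_dist_le ?normr0 ?r0 //; lra.
Qed.

Lemma close_pairs_diagonal (R : realType) (d : nat) (x : nat -> d.-tuple R)
    (N : nat) (r : R) : 0 <= r ->
  (close_pairs x N r)%:R + N%:R
  = \sum_(l < N) \sum_(m < N) (torus_norm (tuple_sub (x l) (x m)) <= r)%R%:R :> R.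
Proof.
move=> r0; rewrite /close_pairs -sum_nat_bool_card.
rewrite -(pair_bigA _ (fun l m : 'I_N =>
  ((l != m) && (torus_norm (tuple_sub (x l) (x m)) <= r)%R)%:R)) /=.
rewrite -[X in _ + X%:R]card_ord -sumr_const -big_split /=.
apply: eq_bigr => l _; rewrite (bigD1 l) //= [RHS](bigD1 l) //=.
rewrite eqxx torus_norm_tuple_subxx // add0r addrC; congr (_ + _).
by apply: eq_bigr => m; rewrite eq_sym => ->.
Qed.

Lemma close_pairs_deviation (R : realType) (d : nat) (x : nat -> d.-tuple R)
    (N : nat) (r : R) :
  (forall n, unit_cube d (x n)) -> (0 < N)%N -> 0 < r -> r + r < 1 ->
  `| (N%:R ^+ 2)^-1 * (close_pairs x N r)%:R - (r + r) ^+ d |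
  <= (6 ^ d)%:R * star_discrepancy x N + N%:R^-1.
Proof.
move=> hx N0 r0 r1; set D := (_ * star_discrepancy x N).
have NN : N%:R != 0 :> R by rewrite pnatr_eq0 -lt0n.
pose f (l : 'I_N) : R :=
  (\sum_(m < N) (torus_norm (tuple_sub (x l) (x m)) <= r)%R%:R) / N%:R.
have -> : (N%:R ^+ 2)^-1 * (close_pairs x N r)%:R - (r + r) ^+ d
    = N%:R^-1 * (\sum_(l < N) (f l - (r + r) ^+ d)) - N%:R^-1.
  rewrite sumrB -mulr_suml -(close_pairs_diagonal _ _ (ltW r0)) sumr_const card_ord.
  by rewrite -mulr_natl; field.
apply: le_trans (ler_normB _ _) _; rewrite [X in _ + X]ger0_norm ?invr_ge0 //.
rewrite lerD2r normrM ger0_norm ?invr_ge0 // ler_pdivrMl ?ltr0n //.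
apply: le_trans (ler_norm_sum _ _ _) _.
rewrite mulr_natl -[X in _ *+ X](card_ord N) -sumr_const.
by apply: ler_sum => l _; exact: torus_ball_deviation.
Qed.

(** Inside [[0, 1)] the arc of radius [r] around [0] splits into [[0, r]] and
    [[1 - r, 1)], disjoint because [2r < 1]. *)
Lemma volume_torus_ball0 (R : realType) (d : nat) (r : R) :
  0 < r -> r + r < 1 -> volume (torus_ball0 d r) = (r + r) ^+ d.
Proof.
move=> r0 r1; rewrite /volume.
pose A : set R := (`[0%R, r] `|` `[1 - r, 1%R[)%classic.
rewrite (_ : torus_ball0 d r = [set t | forall i, A (tnth t i)]%classic); last first.
  apply/seteqP; split => t /=.
    move=> [ht]; rewrite (torus_norm_le _ (ltW r0)) => /forallP h i.
    have := h i; have := ht i => ti; rewrite nearest_int_dist_le; last lra.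
    rewrite /A /= !in_itv /= !ler_norml => hi; apply/orP; lra.
  move=> h; have ht : unit_cube d t.
    by move=> i; have := h i; rewrite /A /= !in_itv /= => -[]; lra.
  split=> //; rewrite (torus_norm_le _ (ltW r0)); apply/forallP => i.
  have := ht i; have := h i; rewrite /A /= !in_itv /= => /orP hi ti.
  rewrite nearest_int_dist_le; last lra.
  rewrite !ler_norml; lra.
have mA : measurable (A : set (measurableTypeR R)) by apply: measurableU.
rewrite (lebesgue_tuple_box (A := fun=> A)) //.
have -> : lebesgue_measure A = (r + r)%:E.
  rewrite measureU //; last first.
    apply/seteqP; split => // y; rewrite /= !in_itv /=; lra.
  have mI (i : interval R) := lebesgue_measure_itv i.
  rewrite [X in X + _ = _]mI [X in _ + X = _]mI /= !lte_fin r0 oppr0 adde0.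
  rewrite ltrBlDr ltrDl r0; transitivity (r + (1 - (1 - r)))%:E => //.
  by congr EFin; ring.
by rewrite prodEFin prodr_const card_ord.
Qed.

(** * Powers beat logarithms *)

Lemma invn_at_right (R : realType) :
  (fun n : nat => (n.+1%:R : R)^-1) @ \oo --> (0 : R)^'+.
Proof.
move=> A /= A0.
have := @cvg_harmonic R.
move=> /(_ _ A0).
move=> H; apply: (@filterS _ \oo _ _ _ _ H) => n /=; apply.
by rewrite invr_gt0.
Qed.

Lemma powR_natN_cvg0 (R : realType) (b : R) : 0 < b ->
  (fun n : nat => n%:R `^ (- b)) @ \oo --> (0 : R).
Proof.
move=> b0; rewrite -(cvg_shiftn 1) /=.
have := cvg_comp _ _ (@invn_at_right R) (powR_cvg0 b0).
apply: cvg_trans; apply: near_eq_cvg; near=> n.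
by rewrite /= addn1 -powR_inv1 // -powRrM mulN1r.
Unshelve. all: by end_near. Qed.

(** Since [ln y < y], taking [y = n^g] gives [ln n <= n^g / g].  With
    [g = b / (2 (k + 1))], a choice that also makes sense for [k = 0], the [k]-th
    power of [ln n] costs less than [n^(b/2)]. *)
Lemma lnX_powR_cvg0 (R : realType) (b : R) (k : nat) : 0 < b ->
  (fun n : nat => n%:R `^ (- b) * ln n%:R ^+ k) @ \oo --> (0 : R).
Proof.
move=> b0.
pose g := b / (k.+1%:R * 2).
have g0 : 0 < g by rewrite divr_gt0 // mulr_gt0.
have bound (n : nat) : (0 < n)%N ->
    0 <= n%:R `^ (- b) * ln n%:R ^+ k <= g ^- k * (n%:R : R) `^ (- (b / 2)).
  move=> n0; have n1 : 1 <= n%:R :> R by rewrite ler1n.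
  have ln0 : 0 <= ln n%:R :> R by exact: ln_ge0.
  rewrite mulr_ge0 ?powR_ge0 ?exprn_ge0 //=.
  have np : 0 < n%:R :> R by rewrite ltr0n.
  have lnb : ln n%:R <= g^-1 * n%:R `^ g :> R.
    rewrite ler_pdivlMl // -ln_powR; apply/ltW/ln_sublinear.
    by rewrite powR_gt0.
  apply: le_trans (_ : n%:R `^ (- b) * (g^-1 * n%:R `^ g) ^+ k <= _).
    rewrite ler_wpM2l ?powR_ge0 // lerXn2r // nnegrE //.
    by rewrite mulr_ge0 ?invr_ge0 ?powR_ge0 // ltW.
  rewrite exprMn exprVn mulrCA ler_wpM2l ?invr_ge0 ?exprn_ge0 ?(ltW g0) //.
  rewrite -powR_mulrn ?powR_ge0 // -powRrM -powRD; last first.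
    by apply/implyP => _; rewrite gt_eqF.
  rewrite ler_powR // /g.
  have : k%:R / k.+1%:R <= 1 :> R by rewrite ler_pdivrMr // mul1r ler_nat.
  move=> /(ler_piMr (ltW b0)); rewrite invfM.
  by move: (k.+1%:R^-1) => i; lra.
apply: (squeeze_cvgr (f := fun=> 0)
  (h := fun n => g ^- k * (n%:R : R) `^ (- (b / 2)))).
- by near=> n; apply: bound; near: n; exact: nbhs_infty_gt.
- exact: cvg_cst.
- rewrite -(mulr0 (g ^- k)); apply: cvgMl_tmp.
  by apply: powR_natN_cvg0; rewrite divr_gt0.
Unshelve. all: by end_near. Qed.

(** * Pair correlations *)

Unset Implicit Arguments.

Theorem corollary1p2 (R : realType) (d : nat) (hd : (1 <= d)%N)
    (x : nat -> d.-tuple R) (hx : low_discrepancy x) :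
  forall alpha : R, 0 < alpha -> alpha < 1 / d%:R -> pair_correlations alpha x.
Proof.
move=> alpha a0; rewrite ltr_pdivlMr ?ltr0n // => ad s s0 /=.
case: hx => xcube /eqO_bigO [K [_ hK]].
pose C := K + 1; pose b := 1 - alpha * d%:R.
have b0 : 0 < b by rewrite /b subr_gt0.
pose bound (N : nat) : R := ((s + s) ^+ d)^-1 *
  ((6 ^ d)%:R * C * (N%:R `^ (- b) * ln N%:R ^+ d) + N%:R `^ (- b) * ln N%:R ^+ 0).
have bound0 : bound @ \oo --> (0 : R).
  have -> : 0 = ((s + s) ^+ d)^-1 * ((6 ^ d)%:R * C * 0 + 0) :> R.
    by rewrite mulr0 addr0 mulr0.
  apply: cvgMl_tmp.
  apply: cvgD; last exact: lnX_powR_cvg0.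
  by apply: cvgMl_tmp; exact: lnX_powR_cvg0.
have r_lt : \forall N \near \oo, s * N%:R `^ (- alpha) < 1 / 2.
  have : s * (N%:R : R) `^ (- alpha) @[N --> \oo] --> s * 0.
    by apply: cvgMl_tmp; exact: powR_natN_cvg0.
  by rewrite mulr0 => /cvgr_lt; apply; rewrite divr_gt0.
have disc : \forall N \near \oo,
    star_discrepancy x N <= C * (N%:R^-1 * ln (N%:R : R) ^+ d).
  near=> N.
  have N1 : (0 < N)%N by near: N; exact: nbhs_infty_gt.
  apply: le_trans (ler_norm _) _.
  have -> : N%:R^-1 * ln (N%:R : R) ^+ d = `|N%:R^-1 * ln (N%:R : R) ^+ d|.
    by rewrite ger0_norm // mulr_ge0 ?invr_ge0 // exprn_ge0 // ln_ge0 // ler1n.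
  near: N; apply: hK.
  by rewrite /C ltrDl ltr01.
apply/cvgrPdist_le => e e0.
have bound_le : \forall N \near \oo, bound N <= e by exact: (cvgr_le _ bound0).
near=> N.
have N0 : (0 < N)%N by near: N; exact: nbhs_infty_gt.
have NR0 : 0 < N%:R :> R by rewrite ltr0n.
set r := s * _.
have r0 : 0 < r by rewrite mulr_gt0 // powR_gt0.
have r1 : r + r < 1.
  have : r < 1 / 2 by rewrite /r; near: N.
  lra.
rewrite (volume_torus_ball0 d r0 r1).
(* N^-b is the inverse of r^d, up to the factor s^d, times 1/N. *)
have bE : N%:R `^ (- b) = (N%:R `^ (- alpha)) ^- d * (N%:R : R)^-1.
  rewrite -(powR_inv1 (ltW NR0)) -(powR_mulrn _ (powR_ge0 _ _)) -powRrM -powRN.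
  rewrite -powRD; last by apply/implyP => _; rewrite gt_eqF.
  by congr powR; rewrite /b; ring.
have rE : (r + r) ^+ d = (s + s) ^+ d * (N%:R `^ (- alpha)) ^+ d.
  by rewrite -exprMn /r -mulrDl.
have v0 : 0 < (r + r) ^+ d by rewrite exprn_gt0 // addr_gt0.
have -> : 1 - (N%:R ^+ 2)^-1 * ((close_pairs x N r)%:R / (r + r) ^+ d)
    = - (((r + r) ^+ d)^-1 *
         ((N%:R ^+ 2)^-1 * (close_pairs x N r)%:R - (r + r) ^+ d)).
  by field; rewrite !gt_eqF.
rewrite normrN normrM ger0_norm ?invr_ge0 ?(ltW v0) //.
apply: (le_trans (y := bound N)); last by near: N.
have -> : bound N = ((r + r) ^+ d)^-1 *
    ((6 ^ d)%:R * (C * (N%:R^-1 * ln (N%:R : R) ^+ d)) + N%:R^-1).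
  rewrite /bound bE rE invfM; ring.
rewrite ler_wpM2l ?invr_ge0 ?(ltW v0) //.
apply: le_trans (close_pairs_deviation xcube N0 r0 r1) _.
rewrite lerD2r ler_wpM2l //.
by near: N.
Unshelve. all: by end_near. Qed.
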